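(* Let $(P,A,\lambda)$ be a marked poset with $\lambda\in\mathbf{Z}^A$, and let $\tilde\phi:\mathbf{R}^{P-A}\to\mathbf{R}^{P-A}$ be the map \[ \tilde\phi(x)_p=\min\Bigl(\{x_p-x_q \mid p\succ q,\ q\notin A\}\cup\{x_p-\lambda_q \mid p\succ q,\ q\in A\}\Bigr)\qquad (p\in P-A). \] Then for every positive integer $m$, $\tilde\phi$ restricts to a bijection between $\mathcal{O}(P,A)_\lambda\cap\frac1m\mathbf{Z}^{P-A}$ and $\mathcal{C}(P,A)_\lambda\cap\frac1m\mathbf{Z}^{P-A}$. Consequently, $\mathcal{O}(P,A)_\lambda$ and $\mathcal{C}(P,A)_\lambda$ have the same Ehrhart polynomial.
   Context: A marked poset $(P,A,\lambda)$ consists of a finite poset $P$, a subset $A\subseteq P$ containing all maximal and all minimal elements of $P$, and a vector $\lambda=(\lambda_a)_{a\in A}$. For $p,q\in P$, $p\succ q$ means $p$ covers $q$: $p>q$ and there is no $r\in P$ with $p>r>q$. The marked order polytope is $\mathcal{O}(P,A)_\lambda=\{x\in\mathbf{R}^{P-A}\mid x_p\le x_q \text{ for } p<q;\ \lambda_a\le x_p \text{ for } a<p;\ x_p\le\lambda_a \text{ for } p<a\}$, where $p,q$ range over $P-A$ and $a$ over $A$. The marked chain polytope is $\mathcal{C}(P,A)_\lambda=\{x\in\mathbf{R}_{\ge0}^{P-A}\mid x_{p_1}+\cdots+x_{p_k}\le\lambda_b-\lambda_a \text{ whenever } a<p_1<\cdots<p_k<b\}$, where $a,b\in A$ and $p_1,\dots,p_k\in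 P-A$. The Ehrhart polynomial $E_Q$ of a polytope $Q$ with integer vertices is the polynomial with $E_Q(t)=|tQ\cap\mathbf{Z}^d|$ for all positive integers $t$; equality of Ehrhart polynomials here means that for every positive integer $t$ the dilates $t\,\mathcal{O}(P,A)_\lambda$ and $t\,\mathcal{C}(P,A)_\lambda$ contain the same number of integer points.
   Formalization: The bijection claim is proved assuming λ_a ≤ λ_b whenever a, b ∈ A and b covers a (true for order-preserving λ); for arbitrary λ it fails, e.g. a<c<p<b with A={a,c,b}, λ=(5,0,10). The Ehrhart claim is proved for all integral λ. *)

(* Defs.v *)
From HB Require Import structures.
From mathcomp Require Import all_boot all_order all_algebra finmap.
From mathcomp Require Import boolp classical_sets functions cardinality reals.

Set Implicit Arguments.
Unset Strict Implicit.
Unset Printing Implicit Defensive.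

Import Order.TTheory GRing.Theory Num.Theory.
Local Open Scope classical_set_scope.
Local Open Scope ring_scope.

Section MarkedPoset.
Variables (d : Order.disp_t) (P : finPOrderType d).

Definition covers (p q : P) : bool :=
  (q < p)%O && [forall r : P, ~~ ((q < r)%O && (r < p)%O)].

Definition contains_extremal (A : {set P}) : Prop :=
  (forall p : P, (forall q : P, ~~ (q < p)%O) -> p \in A) /\
  (forall p : P, (forall q : P, ~~ (p < q)%O) -> p \in A).

Definition marked (A : {set P}) : finType := {a : P | a \in A}.
Definition unmarked (A : {set P}) : finType := {p : P | p \notin A}.

Variables (R : realType) (A : {set P}) (lam : marked A -> R).

(* Implied by monotonicity of lam on A. If this holds but lam a > lam b for  *)
(* some marked a < b, then both polytopes below are empty: on a saturated    *)
(* chain from a to b, lam drops across a run of unmarked elements.           *)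
Definition monotone_on_covers : Prop :=
  forall a b : marked A, covers (val b) (val a) -> lam a <= lam b.

Definition order_polytope : set {ffun unmarked A -> R} :=
  [set x | [/\ forall p q : unmarked A, (val p < val q)%O -> x p <= x q,
               forall (a : marked A) (p : unmarked A),
                 (val a < val p)%O -> lam a <= x p
             & forall (p : unmarked A) (a : marked A),
                 (val p < val a)%O -> x p <= lam a]].

(* The chain a < p_1 < ... < p_k < b has k >= 1; s lists p_1, ..., p_k. *)
Definition chain_polytope : set {ffun unmarked A -> R} :=
  [set x | (forall p : unmarked A, 0 <= x p) /\
           (forall (a b : marked A) (s : seq (unmarked A)), s != [::] ->
              path <%O (val a) (rcons (map val s) (val b)) ->
              \sum_(p <- s) x p <= lam b - lam a)].

(* Minimum of a nonempty list: the default value is itself an entry of the   *)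
(* list. It is 0 on the empty list, which does not occur in phi below when   *)
(* contains_extremal A, since then every unmarked p covers some element.     *)
Definition seqmin (s : seq R) : R := \big[Num.min/head 0 s]_(y <- s) y.

Definition phi (x : {ffun unmarked A -> R}) : {ffun unmarked A -> R} :=
  [ffun p => seqmin
     ([seq x p - x q | q <- enum (unmarked A) & covers (val p) (val q)] ++
      [seq x p - lam a | a <- enum (marked A) & covers (val p) (val a)])].

End MarkedPoset.

Section Lattice.
Variables (R : realType) (U : finType).

Definition dilate (t : R) (Q : set {ffun U -> R}) : set {ffun U -> R} :=
  [set [ffun p => t * (x : {ffun U -> R}) p] | x in Q].

Definition integer_points : set {ffun U -> R} :=
  [set x | forall p : U, x p \is a Num.int].

Definition frac_points (m : nat) : set {ffun U -> R} :=
  dilate m%:R^-1 integer_points.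

Definition ehrhart_set (Q : set {ffun U -> R}) (t : nat) :
    set {ffun U -> R} := dilate t%:R Q `&` integer_points.

(* fset_set sends infinite sets to the empty finite set, so a claim about    *)
(* ehrhart_count is meaningful only together with finiteness of the set.     *)
Definition ehrhart_count (Q : set {ffun U -> R}) (t : nat) : nat :=
  #|` fset_set (ehrhart_set Q t)|%fset.

Definition same_ehrhart (Q1 Q2 : set {ffun U -> R}) : Prop :=
  forall t : nat, (0 < t)%N ->
    [/\ finite_set (ehrhart_set Q1 t), finite_set (ehrhart_set Q2 t)
      & ehrhart_count Q1 t = ehrhart_count Q2 t].

End Lattice.

Arguments frac_points {R U} m.

(* Main.v *)
(** For [x] in the order polytope, extended to [P] by [lam], subtract from
    [x p] the maximum of the extension over all elements below [p], instead of
    only those covered by [p]. This map [transfer] is a bijection from the order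
    polytope onto the chain polytope without any assumption on [lam]: it is
    inverted by solving [x p = y p + max_(q < p) x q] upwards along the order,
    and the solution is the maximum of [lam a + y p_1 + ... + y p_k] over the
    chains [a < p_1 < ... < p_k = p]. When [lam] is monotone on covers, the
    extension of a point of the order polytope is monotone on [P], so that its
    maximum below [p] is reached on a cover and [transfer] agrees with [phi].
    Both maps and their inverses preserve the lattice of denominator [m]; as
    [transfer] needs no monotonicity, it also yields the Ehrhart statement. *)

Require Import Defs.
From HB Require Import structures.
From mathcomp Require Import all_boot all_order all_algebra finmap.
From mathcomp Require Import boolp classical_sets functions cardinality reals.

Set Implicit Arguments.
Unset Strict Implicit.
Unset Printing Implicit Defensive.

Import Order.TTheory GRing.Theory Num.Theory.
Local Open Scope classical_set_scope.
Local Open Scope ring_scope.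

(** * Minima of lists *)

Section SeqMin.
Variable R : realType.
Implicit Types (s : seq R) (y : R).

Lemma seqmin_le s y : y \in s -> seqmin s <= y.
Proof.
rewrite /seqmin; move: (head 0 s) => z; elim: s => // u s IHs.
rewrite inE big_cons ge_min => /predU1P[->|/IHs ->]; first by rewrite lexx.
by rewrite orbT.
Qed.

Lemma seqmin_mem s : s != [::] -> seqmin s \in s.
Proof.
case: s => // u s _; rewrite /seqmin /=.
(* The list folded over becomes any list with entries in [u :: s], while the default [u] stays
   fixed, so that induction applies. *)
have: {subset u :: s <= u :: s} by [].
move: {1 3}(u :: s) => s'; elim: s' => [|v s' IHs] sub.
  by rewrite big_nil mem_head.
rewrite big_cons minElt; case: ifP => _; first by apply: sub; rewrite mem_head.
by apply: IHs => w ws; apply: sub; rewrite inE ws orbT.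
Qed.

End SeqMin.

(** * Heights and covers in a finite poset *)

Section StrictOrder.
Variables (d : Order.disp_t) (P : finPOrderType d).
Implicit Types p q c : P.

(** A strictly increasing measure; it need not be the length of a longest chain. *)
Definition height p : nat := #|[pred q : P | (q < p)%O]|.

Lemma height_lt p q : (q < p)%O -> (height q < height p)%N.
Proof.
move=> qp; apply: proper_card; apply/properP; split.
  by apply/fintype.subsetP => r; rewrite !inE => /lt_trans; apply.
by exists q; rewrite !inE ?ltxx.
Qed.

Lemma finporder_ind (Q : P -> Prop) :
  (forall p, (forall q, (q < p)%O -> Q q) -> Q p) -> forall p, Q p.
Proof.
move=> IH p; have [n] := ubnP (height p); elim: n p => // n IHn p hp.
by apply: IH => q /height_lt qp; apply: IHn; apply: leq_trans qp _.
Qed.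

(** Among the [c] with [q <= c < p], one of largest [height] is covered by [p]: anything strictly
    between would be higher. *)
Lemma covers_above p q : (q < p)%O -> exists2 c, covers p c & (q <= c)%O.
Proof.
move=> qp; pose S c := (q <= c)%O && (c < p)%O.
have Sq : S q by rewrite /S lexx.
case: (arg_maxnP height Sq) => c /andP[qc cp] cmax.
exists c => //; rewrite /covers cp; apply/forallP => r; apply/negP => /andP[cr rp].
have: S r by rewrite /S rp (le_trans qc (ltW cr)).
by move/cmax; rewrite /= leqNgt (height_lt cr).
Qed.

End StrictOrder.

(** * Extension by the marking and the transfer map *)

Section Transfer.
Variables (d : Order.disp_t) (P : finPOrderType d) (R : realType).
Variables (A : {set P}) (lam : marked A -> R).
Hypothesis hA : contains_extremal A.
Local Notation U := (unmarked A).
Implicit Types (x y : {ffun U -> R}) (p : U) (a b : marked A) (q r : P).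

(** The default 0 is never reached, since every element is marked or unmarked. *)
Definition extend x r : R :=
  if insub r is Some p then x p
  else if insub r is Some a then lam a else 0.

Lemma extend_unmarked x p : extend x (val p) = x p.
Proof. by rewrite /extend valK. Qed.

Lemma extend_marked x a : extend x (val a) = lam a.
Proof. by rewrite /extend insubF ?valK // (valP a). Qed.

Variant marking_spec : P -> Prop :=
  | MarkingUnmarked p : marking_spec (val p)
  | MarkingMarked a : marking_spec (val a).

Lemma markingP r : marking_spec r.
Proof.
have [rA|rA] := boolP (r \in A); first exact: (MarkingMarked (Sub r rA)).
exact: (MarkingUnmarked (Sub r rA)).
Qed.

Lemma unmarked_gt_ex p : exists q, (q < val p)%O.
Proof.
apply: contrapT => nq; have := valP p; rewrite hA.1 // => q.
by apply/negP => qp; apply: nq; exists q.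
Qed.

Lemma unmarked_lt_ex p : exists q, (val p < q)%O.
Proof.
apply: contrapT => nq; have := valP p; rewrite hA.2 // => q.
by apply/negP => qp; apply: nq; exists q.
Qed.

Lemma unmarked_gt_marked p : exists a, (val a < val p)%O.
Proof.
case: p => p pA /=; elim/finporder_ind: p pA => p IH pA.
have [q] := unmarked_gt_ex (Sub p pA); rewrite /= => qp.
have [qA|qA] := boolP (q \in A); first by exists (Sub q qA).
by have [a aq] := IH q qp qA; exists a; apply: lt_trans aq qp.
Qed.

(** Among the elements at or above [p], one of largest [height] has nothing above it, so it is
    marked. *)
Lemma unmarked_lt_marked p : exists b, (val p < val b)%O.
Proof.
have Pp : (val p <= val p)%O by [].
case: (arg_maxnP (@height d P) Pp) => q pq qmax.
have [qA|qA] := boolP (q \in A).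
  exists (Sub q qA); rewrite /= lt_neqAle pq andbT.
  by apply: contraTneq qA => <-; apply: (valP p).
have [r] := unmarked_lt_ex (Sub q qA); rewrite /= => qr.
by have := qmax r (le_trans pq (ltW qr)); rewrite /= leqNgt height_lt.
Qed.

(** A maximum, as the opposite of a minimum of opposites, to reuse [seqmin]. The list is nonempty
    when [r] is unmarked. *)
Definition maxbelow x r : R :=
  - seqmin [seq - extend x q | q <- enum P & (q < r)%O].

Lemma maxbelow_ge x q r : (q < r)%O -> extend x q <= maxbelow x r.
Proof.
move=> qr; rewrite lerNr; apply: seqmin_le; apply/mapP; exists q => //.
by rewrite mem_filter qr mem_enum.
Qed.

Lemma maxbelow_eq x p : exists2 q, (q < val p)%O & maxbelow x (val p) = extend x q.
Proof.
rewrite /maxbelow; set s := map _ _.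
have : seqmin s \in s.
  apply: seqmin_mem; have [q qp] := unmarked_gt_ex p.
  rewrite -size_eq0 size_map size_eq0 -has_filter; apply/hasP.
  by exists q; rewrite ?mem_enum.
case/mapP => q; rewrite mem_filter => /andP[qp _] ->.
by exists q; rewrite // opprK.
Qed.

(** Both extensions equal [lam] on marked elements. This locality makes
    [x p = y p + maxbelow x (val p)] a recursion along the order. *)
Lemma eq_maxbelow x y r :
  (forall p, (val p < r)%O -> x p = y p) -> maxbelow x r = maxbelow y r.
Proof.
move=> xy; congr (- seqmin _); apply/eq_in_map => q.
rewrite mem_filter => /andP[]; case: (markingP q) => [p /xy|a] xyp _.
  by rewrite !extend_unmarked xyp.
by rewrite !extend_marked.
Qed.

Definition transfer x : {ffun U -> R} := [ffun p => x p - maxbelow x (val p)].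

Lemma unmarked_ind (Q : U -> Prop) :
  (forall p, (forall p', (val p' < val p)%O -> Q p') -> Q p) -> forall p, Q p.
Proof.
move=> IH [p pA]; elim/finporder_ind: p pA => p IHp pA.
by apply: IH => -[q qA] qp; apply: IHp.
Qed.

Lemma transfer_inj : injective transfer.
Proof.
move=> x y /ffunP xy; apply/ffunP => p; elim/unmarked_ind: p => p IH.
by have := xy p; rewrite !ffunE (eq_maxbelow IH) => /addIr.
Qed.

Lemma transfer_surj y : exists x, transfer x = y.
Proof.
pose F x : {ffun U -> R} := [ffun p => y p + maxbelow x (val p)].
(* After [n] rounds the coordinates of height below [n] have stabilised. *)
have stab n p : (height (val p) < n)%N -> iter n F y p = iter n.+1 F y p.
  elim: n p => // n IHn p hp; rewrite /= 2!ffunE; congr (_ + _).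
  apply: eq_maxbelow => q /height_lt qp.
  by rewrite IHn //; apply: leq_trans qp _.
(* Heights are at most [#|P|], so every coordinate is stable by this round. *)
exists (iter #|P|.+1 F y); apply/ffunP => p; rewrite ffunE.
by rewrite stab ?ltnS ?max_card //= ffunE addrK.
Qed.

(** * Correspondence of the two polytopes *)

Lemma transfer_le x p q : (q < val p)%O -> transfer x p <= x p - extend x q.
Proof. by move=> qp; rewrite ffunE lerD2l lerN2 maxbelow_ge. Qed.

Lemma order_polytope_extend_le x p q :
  order_polytope lam x -> (q < val p)%O -> extend x q <= x p.
Proof.
move=> [Oxx Oax _]; case: (markingP q) => [p'|a].
  by rewrite extend_unmarked; apply: Oxx.
by rewrite extend_marked; apply: Oax.
Qed.

(** Each term is at most the difference of consecutive values of the extension along the chain, and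
    these differences telescope. *)
Lemma sum_transfer_le x q (s : seq U) : path <%O q (map val s) ->
  \sum_(p <- s) transfer x p <= extend x (last q (map val s)) - extend x q.
Proof.
elim: s q => [|p s IHs] q /=; first by rewrite big_nil subrr.
move=> /andP[qp /IHs]; rewrite big_cons => le_s.
apply: le_trans (lerD (transfer_le x qp) le_s) _.
by rewrite extend_unmarked [X in X <= _]addrC addrA subrK.
Qed.

Lemma transfer_chain_polytope x :
  order_polytope lam x -> chain_polytope lam (transfer x).
Proof.
move=> Ox; split=> [p|a b s].
  rewrite ffunE subr_ge0; have [q qp ->] := maxbelow_eq x p.
  exact: order_polytope_extend_le.
case/lastP: s => // s p _; rewrite rcons_path => /andP[pth].
rewrite map_rcons last_rcons => pb; apply: le_trans (sum_transfer_le x pth) _.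
rewrite map_rcons last_rcons extend_unmarked extend_marked lerD2r.
by case: Ox => _ _; apply.
Qed.

(** Descending from [p] through elements where the maximum below is reached, until one is marked,
    gives a chain along which the telescoping bound is an equality. *)
Lemma transfer_chain_sum x p : exists a (s : seq U),
  path <%O (val a) (map val (rcons s p)) /\
  x p = lam a + \sum_(p' <- rcons s p) transfer x p'.
Proof.
elim/unmarked_ind: p => p IH; have [q] := maxbelow_eq x p.
case: (markingP q) => [p' p'p|a ap] eqp.
  have [a [s [pth xp']]] := IH p' p'p; exists a, (rcons s p'); split.
    by rewrite map_rcons rcons_path pth map_rcons last_rcons.
  rewrite big_rcons /= addrA -xp' [transfer x p]ffunE eqp.
  by rewrite extend_unmarked addrC subrK.
exists a, [::]; split; first by rewrite /= ap.
by rewrite big_seq1 ffunE eqp extend_marked addrC subrK.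
Qed.

Lemma order_polytope_transfer x :
  chain_polytope lam (transfer x) -> order_polytope lam x.
Proof.
move=> [C0 Cs].
have below q p : (q < val p)%O -> extend x q <= x p.
  move=> /maxbelow_ge/le_trans; apply.
  by have := C0 p; rewrite ffunE subr_ge0.
split=> [p q /below|a p /below|p b pb]; rewrite ?extend_unmarked ?extend_marked //.
(* The upper bound [lam b] is the chain inequality for the chain that computes [x p], closed by
   [b]. *)
have [a [s [pth ->]]] := transfer_chain_sum x p.
rewrite -lerBrDl; apply: Cs; first by case: (s).
by rewrite rcons_path pth map_rcons last_rcons.
Qed.

(** The amount subtracted at [p] is a mark or a coordinate of [x] below [p], so integrality passes
    to [transfer x] directly and back by induction along the order. *)
Lemma transfer_int (m : R) x : (forall a, m * lam a \is a Num.int) ->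
  (forall p, m * transfer x p \is a Num.int) <->
  (forall p, m * x p \is a Num.int).
Proof.
move=> mlam; split=> mx p; last first.
  rewrite ffunE; have [q _ ->] := maxbelow_eq x p; rewrite mulrBr rpredB //.
  by case: (markingP q) => [p'|a]; rewrite ?extend_unmarked ?extend_marked.
elim/unmarked_ind: p => p IH.
have := mx p; rewrite ffunE; have [q qp ->] := maxbelow_eq x p.
rewrite mulrBr rpredBr //; case: (markingP q) qp => [p' /IH|a _].
  by rewrite extend_unmarked.
by rewrite extend_marked.
Qed.

Lemma frac_pointsP m x : (0 < m)%N ->
  frac_points m x <-> forall p, m%:R * x p \is a Num.int.
Proof.
move=> m0; have mn0 : m%:R != 0 :> R by rewrite pnatr_eq0 -lt0n.
split=> [[z zint <-] p|mx]; first by rewrite ffunE mulVKf.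
exists [ffun p => m%:R * x p]; first by move=> p; rewrite ffunE.
by apply/ffunP => p; rewrite !ffunE mulKf.
Qed.

Lemma transfer_bij m : (forall a, lam a \is a Num.int) -> (0 < m)%N ->
  set_bij (order_polytope lam `&` frac_points m)
          (chain_polytope lam `&` frac_points m) transfer.
Proof.
move=> lamZ m0.
have mlam a : m%:R * lam a \is a Num.int by rewrite rpredM ?rpred_nat.
split.
- move=> x [Ox /(frac_pointsP _ m0) xZ]; split; first exact: transfer_chain_polytope.
  by apply/(frac_pointsP _ m0)/(transfer_int _ mlam).
- by move=> x y _ _; apply: transfer_inj.
- move=> y [Cy /(frac_pointsP _ m0) yZ]; have [x xy] := transfer_surj y.
  rewrite -xy in Cy yZ *; exists x => //; split.
    exact: order_polytope_transfer.
  by apply/(frac_pointsP _ m0)/(transfer_int _ mlam).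
Qed.

(** Descend from [r] by covers lying above [q]. Monotonicity of [lam] serves the covers between two
    marked elements; the polytope inequalities give the others. *)
Lemma extend_homo x : monotone_on_covers lam -> order_polytope lam x ->
  {homo extend x : q r / (q <= r)%O >-> q <= r}.
Proof.
move=> mono Ox q r; elim/finporder_ind: r q => r IH q.
rewrite le_eqVlt => /predU1P[->//|/covers_above[c rc /IH qc]].
have cr : (c < r)%O by case/andP: rc.
apply: le_trans (qc cr) _; case: (markingP r) cr rc => [p|b] cr rc.
  by rewrite extend_unmarked; apply: order_polytope_extend_le.
case: (markingP c) cr rc => [p|a] cr rc; rewrite ?extend_unmarked !extend_marked.
  by case: Ox => _ _; apply.
exact: mono.
Qed.

Lemma phi_transfer x : monotone_on_covers lam -> order_polytope lam x ->
  phi lam x = transfer x.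
Proof.
move=> mono Ox; apply/ffunP => p; rewrite [LHS]ffunE; set s := _ ++ _.
(* Through [extend], the marked and unmarked halves of the list become a single family indexed by
   covers. *)
have sP z : reflect (exists2 q, covers (val p) q & z = x p - extend x q) (z \in s).
  rewrite mem_cat; apply: (iffP orP) => [[]/mapP[q]|[q]].
  - rewrite mem_filter => /andP[pq _] ->; exists (val q) => //.
    by rewrite extend_unmarked.
  - rewrite mem_filter => /andP[pq _] ->; exists (val q) => //.
    by rewrite extend_marked.
  case: (markingP q) => [p'|a] pq ->; [left|right]; apply/mapP.
    by exists p'; rewrite ?extend_unmarked // mem_filter pq mem_enum.
  by exists a; rewrite ?extend_marked // mem_filter pq mem_enum.
apply/eqP; rewrite eq_le; apply/andP; split.
  (* The element reaching the maximum lies under some cover [c], where the extension is at least as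
     large. *)
  rewrite ffunE; have [q /covers_above[c pc qc] ->] := maxbelow_eq x p.
  apply: le_trans (_ : x p - extend x c <= _).
    by apply: seqmin_le; apply/sP; exists c.
  by rewrite lerD2l lerN2 extend_homo.
have /sP[q /andP[qp _] ->] : seqmin s \in s; last exact: transfer_le.
apply: seqmin_mem; have [q /covers_above[c pc _]] := unmarked_gt_ex p.
have : x p - extend x c \in s by apply/sP; exists c.
by case: (s).
Qed.

End Transfer.

(** * Integer points in dilates *)

Section Ehrhart.
Variables (R : realType) (U : finType).
Implicit Types Q : set {ffun U -> R}.

(** Scaling by [t] links the Ehrhart count to the bijection on points of denominator [t]. *)
Lemma ehrhart_set_image Q t : (0 < t)%N ->
  ehrhart_set Q t =
  (fun x : {ffun U -> R} => [ffun p => t%:R * x p]) @` (Q `&` frac_points t).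
Proof.
move=> t0; have tn0 : t%:R != 0 :> R by rewrite pnatr_eq0 -lt0n.
apply/seteqP; split=> [_ [[x Qx <-] xZ]|_ [x [Qx [z zZ xz]] <-]].
  exists x => //; split=> //; exists [ffun p => t%:R * x p] => //.
  by apply/ffunP => p; rewrite !ffunE mulKf.
split; first by exists x.
by move=> p; rewrite -xz !ffunE mulVKf.
Qed.

Lemma card_ehrhart_set Q t : (0 < t)%N ->
  (ehrhart_set Q t #= Q `&` frac_points t)%card.
Proof.
move=> t0; have tn0 : t%:R != 0 :> R by rewrite pnatr_eq0 -lt0n.
rewrite ehrhart_set_image //; apply: inj_card_eq => x y _ _ /ffunP xy.
by apply/ffunP => p; have := xy p; rewrite !ffunE => /(mulfI tn0).
Qed.

Lemma finite_ehrhart_set Q t (k : nat) :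
  (forall x p, Q x -> `|x p| <= k%:R) -> finite_set (ehrhart_set Q t).
Proof.
move=> Qk; pose N := (t * k)%N.
(* Integers from [-N] to [N] are encoded, after a shift by [N], as the [2N + 1] ordinals. *)
pose f (g : {ffun U -> 'I_(N + N).+1}) : {ffun U -> R} := [ffun p => (g p)%:R - N%:R].
apply: (@sub_finite_set _ _ (f @` setT)); last first.
  exact/finite_image/finite_finset.
move=> _ [[x Qx <-] xZ].
have bnd p : `|t%:R * x p| <= N%:R.
  by rewrite normrM normr_nat natrM ler_wpM2l ?Qk.
have /choice[g gE] p : exists i : 'I_(N + N).+1, i%:R = t%:R * x p + N%:R.
  have: t%:R * x p + N%:R \is a Num.nat.
    rewrite natrEint rpredD ?rpred_nat //; last by have := xZ p; rewrite ffunE.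
    by have := bnd p; rewrite ler_norml -subr_ge0 opprK => /andP[].
  case/natrP => n nE; have nN : (n < (N + N).+1)%N.
    rewrite ltnS -(ler_nat R) -nE natrD lerD2r.
    by apply: le_trans (bnd p); rewrite ler_norm.
  by exists (Ordinal nN).
by exists (finfun g) => //; apply/ffunP => p; rewrite !ffunE gE addrK.
Qed.

End Ehrhart.

(** Every unmarked element lies between two marked ones, so each coordinate lies between two entries
    of [lam]. *)
Lemma order_polytope_bounded (R : realType) (d : Order.disp_t)
    (P : finPOrderType d) (A : {set P}) (lam : marked A -> R) :
  contains_extremal A -> exists k : nat,
  forall x p, order_polytope lam x -> `|x p| <= k%:R.
Proof.
move=> hA; pose S := \sum_(a : marked A) `|lam a|.
have lamS a : `|lam a| <= S.
  by rewrite /S (bigD1 a) //= lerDl sumr_ge0.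
exists (Num.bound S) => x p [_ Oax Oxa].
apply: (@le_trans _ _ S); last first.
  by rewrite ltW // archi_boundP // sumr_ge0.
have [a /Oax ax] := unmarked_gt_marked hA p.
have [b /Oxa xb] := unmarked_lt_marked hA p.
rewrite ler_norml (le_trans xb (le_trans (ler_norm _) (lamS b))) andbT.
apply: le_trans ax; rewrite lerNl.
by apply: le_trans (lamS a); rewrite -normrN ler_norm.
Qed.

Theorem theorem3p5 (R : realType) (d : Order.disp_t) (P : finPOrderType d)
    (A : {set P}) (lam : marked A -> R)
    (hA : contains_extremal A)
    (hlam : forall a : marked A, lam a \is a Num.int) :
  (monotone_on_covers lam ->
   forall m : nat, (0 < m)%N ->
     set_bij (order_polytope lam `&` frac_points m)
             (chain_polytope lam `&` frac_points m)
             (phi lam)) /\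
  same_ehrhart (order_polytope lam) (chain_polytope lam).
Proof.
split=> [mono m m0|t t0].
  apply: eq_set_bijLR (transfer_bij hA hlam m0) => x; rewrite inE => -[Ox _].
  by rewrite phi_transfer.
have [k bk] := order_polytope_bounded lam hA.
have finO : finite_set (ehrhart_set (order_polytope lam) t).
  exact: finite_ehrhart_set bk.
have eqOC :
    (ehrhart_set (order_polytope lam) t #= ehrhart_set (chain_polytope lam) t)%card.
  apply: card_eq_trans (card_ehrhart_set _ t0) _.
  apply: card_eq_trans (card_esym (card_ehrhart_set _ t0)).
  by have [g _] := Pbij (transfer_bij hA hlam t0); apply: pcard_eq g.
(* Finiteness is carried over by the bijection instead of bounding the chain polytope. *)
have finC : finite_set (ehrhart_set (chain_polytope lam) t).
  by rewrite -(eq_finite_set eqOC).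
by split=> //; apply/fcard_eq.
Qed.
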